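(* Let $k$ be an algebraically closed field of arbitrary characteristic and $S=k[[\alpha_1,\dots,\alpha_n]]$. Let $\varphi:S\to S$ be a $k$-algebra automorphism and let $D_i=\varphi(\alpha_i)-\alpha_i$ for $i=1,\dots,n$. For $\mathbf a\in\mathbb N_0^n$ denote $\mathbf D^{\mathbf a}=D_1^{a_1}\cdots D_n^{a_n}$. Let $f\in P$. Then $$\varphi^\vee(f)=\sum_{\mathbf a\in\mathbb N_0^n}\mathbf x^{[\mathbf a]}\cdot\left(\mathbf D^{\mathbf a}\lrcorner f\right)=f+\sum_{i=1}^n x_i\cdot(D_i\lrcorner f)+\cdots .$$
   Context: Let $\mathfrak m$ be the maximal ideal of $S$. $P$ is the space of $k$-linear functionals $f:S\to k$ vanishing on $\mathfrak m^D$ for all $D\gg0$; the pairing is denoted $\langle-,-\rangle:S\times P\to k$. It has a basis $\mathbf x^{[\mathbf a]}$, $\mathbf a\in\mathbb N_0^n$, dual to the monomials $\alpha^{\mathbf a}$: $\langle\alpha^{\mathbf b},\mathbf x^{[\mathbf a]}\rangle=1$ if $\mathbf a=\mathbf b$ and $0$ otherwise; $x_i$ is the element dual to $\alpha_i$. $S$ acts on $P$ by contraction, $\langle\tau,\sigma\lrcorner f\rangle=\langle\tau\sigma,f\rangle$ for all $\tau\in S$. $P$ is a (divided power) ring with multiplication $\mathbf x^{[\mathbf a]}\cdot\mathbf x^{[\mathbf b]}=\binom{\mathbf a+\mathbf b}{\mathbf a}\mathbf x^{[\mathbf a+\mathbf b]}$, where $\binom{\mathbf a+\mathbf b}{\mathbf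 a}=\prod_i\binom{a_i+b_i}{a_i}$. The dual map $\varphi^\vee:P\to P$ is defined by $\langle\sigma,\varphi^\vee(f)\rangle=\langle\varphi(\sigma),f\rangle$ for all $\sigma\in S$, $f\in P$. *)

(* Defs.v *)
From HB Require Import structures.
From mathcomp Require Import all_boot all_order all_algebra.
From mathcomp Require Import boolp classical_sets functions cardinality fsbigop.
From mathcomp Require Import mpoly.

Set Implicit Arguments.
Unset Strict Implicit.
Unset Printing Implicit Defensive.

Import GRing.Theory.
Local Open Scope ring_scope.
Local Open Scope classical_set_scope.

(* Multi-indices in N^n are the multinomials 'X_{1..n} of the mpoly library. *)

Section BoundedSums.
Variables (n : nat) (V : nmodType).
Implicit Types (F : 'X_{1..n} -> V).

Lemma bsum_fsum d F : (forall a, (d <= mdeg a)%N -> F a = 0) ->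
  \sum_(a : 'X_{1..n < d}) F a = \sum_(a \in [set: 'X_{1..n}]) F a.
Proof.
move=> F0; set r := [seq bmnm a | a <- enum {: 'X_{1..n < d}}].
rewrite -[LHS]big_enum -(big_map (@bmnm n d) xpredT F) -/r.
have ur : uniq r by rewrite map_inj_uniq ?enum_uniq //; exact: val_inj.
rewrite bigfs //; last first.
  move=> a _ ar; apply: F0; rewrite leqNgt; apply: contra ar => ad.
  by apply/mapP; exists (@BMultinom n d a ad); rewrite ?mem_enum.
by congr (\sum_(a \in _) F a); apply/seteqP; split.
Qed.

Lemma bsum_widen d d' F : (d <= d')%N ->
  (forall a, (d <= mdeg a)%N -> F a = 0) ->
  \sum_(a : 'X_{1..n < d'}) F a = \sum_(a : 'X_{1..n < d}) F a.
Proof.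
move=> dd' F0; rewrite !bsum_fsum // => a d'a.
by apply: F0; exact: leq_trans d'a.
Qed.

Lemma bsum_pred1 d x F : ((d <= mdeg x)%N -> F x = 0) ->
  \sum_(a : 'X_{1..n < d}) (if x == a then F a else 0) = F x.
Proof.
move=> F0; case: (ltnP (mdeg x) d) => [xd|dx].
  rewrite (bigD1 (@BMultinom n d x xd)) //= eqxx big1 ?addr0 // => a.
  by rewrite bmeqP /= eq_sym => /negPf ->.
rewrite F0 // big1 // => a _; case: eqP => // xa.
by move: (bmdeg a); rewrite -xa ltnNge dx.
Qed.

End BoundedSums.

(* Convolution of coefficient families with weights w; the constant weight 1  *)
(* gives the Cauchy product, binomial weights give divided powers.            *)
Section Convolution.
Variables (n : nat) (R : comNzRingType) (w : 'X_{1..n} -> 'X_{1..n} -> R).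
Implicit Types (f g h : 'X_{1..n} -> R) (m : 'X_{1..n}).

Definition conv f g m : R :=
  \sum_(ab : 'X_{1..n < (mdeg m).+1, (mdeg m).+1} | m == (ab.1 + ab.2)%MM)
     w ab.1 ab.2 * (f ab.1 * g ab.2).

Lemma convE d f g m : (mdeg m < d)%N -> conv f g m =
  \sum_(a : 'X_{1..n < d}) \sum_(b : 'X_{1..n < d})
     if m == (a + b)%MM then w a b * (f a * g b) else 0.
Proof.
move=> md.
rewrite /conv big_mkcond /= -(pair_bigA _ (fun (a b : 'X_{1..n < (mdeg m).+1}) =>
   if m == (a + b)%MM then w a b * (f a * g b) else 0)) /=.
rewrite -(@bsum_widen _ _ (mdeg m).+1 d (fun a =>
   \sum_(b : 'X_{1..n < (mdeg m).+1})
     if m == (a + b)%MM then w a b * (f a * g b) else 0)) //; last first.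
  move=> a ma; rewrite big1 // => b _; case: eqP => // E.
  by have := congr1 mdeg E; rewrite mdegD => Em; rewrite Em ltnNge leq_addr in ma.
apply: eq_bigr => a _.
rewrite -(@bsum_widen _ _ (mdeg m).+1 d (fun b =>
     if m == (a + b)%MM then w a b * (f a * g b) else 0)) // => b mb.
case: eqP => // E.
by have := congr1 mdeg E; rewrite mdegD => Em; rewrite Em ltnNge leq_addl in mb.
Qed.

Lemma eq_conv f f' g g' m :
  (forall a, (mdeg a <= mdeg m)%N -> f a = f' a) ->
  (forall a, (mdeg a <= mdeg m)%N -> g a = g' a) ->
  conv f g m = conv f' g' m.
Proof.
move=> ff' gg'; apply: eq_bigr => -[a b] /= _.
by rewrite ff' ?gg' // -ltnS; exact: bmdeg.
Qed.

Lemma convDl f g h m : conv (fun a => f a + g a) h m = conv f h m + conv g h m.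
Proof. by rewrite -big_split; apply: eq_bigr => a _; rewrite mulrDl mulrDr. Qed.

Lemma convZl c f g m : conv (fun a => c * f a) g m = c * conv f g m.
Proof. by rewrite /conv big_distrr; apply: eq_bigr => ab _ /=; rewrite -mulrA mulrCA. Qed.

(* Convolution with a delta family. *)
Lemma conv_delta a g m :
  conv (fun b => (b == a)%:R) g m =
  if (a <= m)%MM then w a (m - a)%MM * g (m - a)%MM else 0.
Proof.
pose d := (mdeg m).+1.
rewrite (@convE d) //.
have -> : \sum_(x : 'X_{1..n < d}) \sum_(b : 'X_{1..n < d})
     (if m == (x + b)%MM then w x b * (((bmnm x) == a)%:R * g b) else 0) =
   \sum_(x : 'X_{1..n < d}) (if a == x then \sum_(b : 'X_{1..n < d})
     (if m == (x + b)%MM then w x b * g b else 0) else 0).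
  apply: eq_bigr => x _; case: (eqVneq a x) => [<-|ax].
    by apply: eq_bigr => b _; rewrite mul1r.
  apply: big1 => b _; rewrite mul0r mulr0.
  by case: ifP.
rewrite (@bsum_pred1 _ _ d a (fun x => \sum_(b : 'X_{1..n < d})
     (if m == (x + b)%MM then w x b * g b else 0))); last first.
  move=> da; apply: big1 => b _; case: eqP => // E.
  by have := congr1 mdeg E; rewrite mdegD => Em; rewrite /d Em ltnNge leq_addr in da.
case: ifP => am; last first.
  by apply: big1 => b _; case: eqP => // E; move: am; rewrite E lem_addr.
rewrite -(@bsum_pred1 _ _ d (m - a)%MM (fun b => w a b * g b)); last first.
  by rewrite leqNgt ltnS mdegB.
apply: eq_bigr => b _; congr (if _ then _ else _).
by rewrite -{1}(submK am) addmC eqm_add2l.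
Qed.

Hypothesis wC : forall a b, w a b = w b a.

Lemma convC f g m : conv f g m = conv g f m.
Proof.
rewrite !(@convE (mdeg m).+1) // exchange_big.
apply: eq_bigr => a _; apply: eq_bigr => b _ /=.
by rewrite addmC wC [f b * _]mulrC.
Qed.

Hypothesis wA : forall a b c, w (a + b)%MM c * w a b = w a (b + c)%MM * w b c.

Let convl f g h m : let d := (mdeg m).+1 in
  conv (conv f g) h m =
  \sum_(a : 'X_{1..n < d}) \sum_(b : 'X_{1..n < d}) \sum_(c : 'X_{1..n < d})
    if m == (a + b + c)%MM then w (a + b)%MM c * w a b * (f a * g b * h c) else 0.
Proof.
move=> d; rewrite (@convE d) //.
transitivity (\sum_(x : 'X_{1..n < d}) \sum_(c : 'X_{1..n < d})
   \sum_(a : 'X_{1..n < d}) \sum_(b : 'X_{1..n < d})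
   if (a + b)%MM == x then if m == (x + c)%MM then
      w x c * w a b * (f a * g b * h c) else 0 else 0).
  apply: eq_bigr => x _; apply: eq_bigr => c _.
  case: (eqVneq m (x + c)%MM) => [mxc|_]; last first.
    by rewrite big1 // => a _; rewrite big1 // => b _; case: ifP.
  rewrite (@convE d) ?bmdeg // big_distrl big_distrr; apply: eq_bigr => a _ /=.
  rewrite big_distrl big_distrr; apply: eq_bigr => b _ /=.
  by rewrite eq_sym; case: ifP => _; rewrite ?mul0r ?mulr0 // !mulrA.
transitivity (\sum_(c : 'X_{1..n < d}) \sum_(a : 'X_{1..n < d})
   \sum_(b : 'X_{1..n < d}) \sum_(x : 'X_{1..n < d})
   if (a + b)%MM == x then if m == (x + c)%MM then
      w x c * w a b * (f a * g b * h c) else 0 else 0).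
  rewrite exchange_big; apply: eq_bigr => c _ /=.
  by rewrite exchange_big; apply: eq_bigr => a _ /=; rewrite exchange_big.
rewrite exchange_big; apply: eq_bigr => a _ /=.
rewrite exchange_big; apply: eq_bigr => b _ /=; apply: eq_bigr => c _.
rewrite (@bsum_pred1 _ _ d (a + b)%MM (fun x => if m == (x + c)%MM then
      w x c * w a b * (f a * g b * h c) else 0)) //.
move=> dab; case: eqP => // E.
have := congr1 mdeg E; rewrite mdegD => Em.
by have := leq_addr (mdeg c) (mdeg (a + b)); rewrite -Em leqNgt dab.
Qed.

Lemma convA f g h m : conv f (conv g h) m = conv (conv f g) h m.
Proof.
rewrite convC !convl.
under eq_bigr do rewrite exchange_big /=.
rewrite exchange_big /=.
apply: eq_bigr => a _; apply: eq_bigr => b _; apply: eq_bigr => c _.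
rewrite -[(b + c + a)%MM]addmC addmA; case: ifP => // _.
by rewrite [w (b + c)%MM a]wC -wA -[f a * g b * h c]mulrA [f a * _]mulrC.
Qed.

End Convolution.

(* k[[alpha_1, ..., alpha_n]]: a power series is its family of coefficients.  *)
Record mseries (n : nat) (k : Type) := MSeries { mscoef : 'X_{1..n} -> k }.

Section PowerSeries.
Variables (n : nat) (k : fieldType).
Local Notation S := (mseries n k).
Implicit Types (s t u : mseries n k).

HB.instance Definition _ := [isNew for @mscoef n k].
HB.instance Definition _ := [Choice of mseries n k by <:].

Lemma mseriesP s t : mscoef s =1 mscoef t -> s = t.
Proof. by move=> st; apply: val_inj; apply: funext. Qed.

Definition ms_zero : S := MSeries (fun=> 0).
Definition ms_opp s : S := MSeries (fun m => - mscoef s m).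
Definition ms_add s t : S := MSeries (fun m => mscoef s m + mscoef t m).
Definition ms_scale (c : k) s : S := MSeries (fun m => c * mscoef s m).
Definition monomial (a : 'X_{1..n}) : S := MSeries (fun m => (m == a)%:R).
Definition ms_mul s t : S := MSeries (fun m =>
  \sum_(ab : 'X_{1..n < (mdeg m).+1, (mdeg m).+1} | m == (ab.1 + ab.2)%MM)
     mscoef s ab.1 * mscoef t ab.2).

Fact ms_addA : associative ms_add.
Proof. by move=> s t u; apply: mseriesP => m /=; rewrite addrA. Qed.
Fact ms_addC : commutative ms_add.
Proof. by move=> s t; apply: mseriesP => m /=; rewrite addrC. Qed.
Fact ms_add0 : left_id ms_zero ms_add.
Proof. by move=> s; apply: mseriesP => m /=; rewrite add0r. Qed.
Fact ms_addN : left_inverse ms_zero ms_opp ms_add.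
Proof. by move=> s; apply: mseriesP => m /=; rewrite addNr. Qed.

HB.instance Definition _ :=
  GRing.isZmodule.Build (mseries n k) ms_addA ms_addC ms_add0 ms_addN.

Local Notation ms_conv := (conv (fun _ _ : 'X_{1..n} => 1 : k)).

Let ms_mulE s t m : mscoef (ms_mul s t) m = ms_conv (mscoef s) (mscoef t) m.
Proof. by apply: eq_bigr => ab _; rewrite mul1r. Qed.

Let mscoef_mul s t : mscoef (ms_mul s t) = ms_conv (mscoef s) (mscoef t).
Proof. by apply: funext => m; rewrite ms_mulE. Qed.

Fact ms_mulC : commutative ms_mul.
Proof. by move=> s t; apply: mseriesP => m; rewrite !ms_mulE convC. Qed.
Fact ms_mulA : associative ms_mul.
Proof.
by move=> s t u; apply: mseriesP => m; rewrite !mscoef_mul convA.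
Qed.
Fact ms_mul1 : left_id (monomial 0%MM) ms_mul.
Proof.
move=> s; apply: mseriesP => m; rewrite mscoef_mul conv_delta subm0 mul1r.
by case: ifP => // /negP[]; apply/mnm_lepP => i; rewrite mnm0E.
Qed.
Fact ms_mulDl : left_distributive ms_mul ms_add.
Proof. by move=> s t u; apply: mseriesP => m; rewrite [LHS]ms_mulE convDl -!ms_mulE. Qed.
Fact ms_1neq0 : monomial 0%MM != 0 :> S.
Proof.
apply/eqP => /(congr1 (fun s => mscoef s 0%MM)) /=.
by rewrite eqxx => /eqP; rewrite oner_eq0.
Qed.

HB.instance Definition _ := GRing.Zmodule_isComNzRing.Build (mseries n k)
  ms_mulA ms_mulC ms_mul1 ms_mulDl ms_1neq0.

Fact ms_scaleA a b s : ms_scale a (ms_scale b s) = ms_scale (a * b) s.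
Proof. by apply: mseriesP => m /=; rewrite mulrA. Qed.
Fact ms_scale1 : left_id 1 ms_scale.
Proof. by move=> s; apply: mseriesP => m /=; rewrite mul1r. Qed.
Fact ms_scaleDr : right_distributive ms_scale +%R.
Proof. by move=> c s t; apply: mseriesP => m /=; rewrite mulrDr. Qed.
Fact ms_scaleDl s : {morph ms_scale^~ s : a b / a + b}.
Proof. by move=> a b; apply: mseriesP => m /=; rewrite mulrDl. Qed.

HB.instance Definition _ := GRing.Zmodule_isLmodule.Build k (mseries n k)
  ms_scaleA ms_scale1 ms_scaleDr ms_scaleDl.

Fact ms_scaleAl (c : k) s t : c *: (s * t) = (c *: s) * t.
Proof.
apply: mseriesP => m; rewrite [LHS]/(c * mscoef (ms_mul s t) m).
by rewrite [RHS]ms_mulE (@convZl _ _ _ c (mscoef s)) ms_mulE.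
Qed.

HB.instance Definition _ := GRing.Lmodule_isLalgebra.Build k (mseries n k)
  ms_scaleAl.
HB.instance Definition _ := GRing.Lalgebra_isComAlgebra.Build k (mseries n k).

Lemma mscoef0 m : mscoef (0 : S) m = 0. Proof. by []. Qed.
Lemma mscoefD s t m : mscoef (s + t) m = mscoef s m + mscoef t m.
Proof. by []. Qed.
Lemma mscoefB s t m : mscoef (s - t) m = mscoef s m - mscoef t m.
Proof. by []. Qed.
Lemma mscoefZ c s m : mscoef (c *: s) m = c * mscoef s m. Proof. by []. Qed.
Lemma mscoef1 m : mscoef (1 : S) m = (m == 0%MM)%:R. Proof. by []. Qed.
Lemma mscoefM s t m : mscoef (s * t) m =
  \sum_(ab : 'X_{1..n < (mdeg m).+1, (mdeg m).+1} | m == (ab.1 + ab.2)%MM)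
     mscoef s ab.1 * mscoef t ab.2.
Proof. by []. Qed.
Lemma mscoef_sum (I : Type) (r : seq I) (Q : pred I) (F : I -> S) m :
  mscoef (\sum_(i <- r | Q i) F i) m = \sum_(i <- r | Q i) mscoef (F i) m.
Proof. by elim/big_rec2: _ => //= i x y _ <-. Qed.

Lemma mscoefXM a s m : mscoef (monomial a * s) m =
  if (a <= m)%MM then mscoef s (m - a)%MM else 0.
Proof. by rewrite [LHS]ms_mulE conv_delta mul1r. Qed.

Lemma monomialD a b : monomial (a + b)%MM = monomial a * monomial b.
Proof.
apply: mseriesP => m; rewrite mscoefXM /=; case: ifP => am.
  by rewrite -{1}(submK am) addmC eqm_add2l.
by case: eqP => // E; move: am; rewrite E lem_addr.
Qed.

(* The maximal ideal of the local ring S; see [max_idealP]. *)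
Definition max_ideal : {pred S} := [pred s | mscoef s 0%MM == 0].

Lemma mscoef_prod D (c : S) (x : 'I_D -> S) m :
  (forall j, x j \in max_ideal) -> (mdeg m < D)%N ->
  mscoef (c * \prod_j x j) m = 0.
Proof.
elim: D c x m => // D IH c x m xm mD.
rewrite big_ord_recl mulrCA mscoefM big1 // => ab /eqP E.
have [a0|a0] := eqVneq (bmnm ab.1) 0%MM.
  by rewrite a0 (eqP (xm ord0 : is_true (mscoef _ _ == 0))) mul0r.
have bD : (mdeg ab.2 < D)%N.
  rewrite -ltnS; apply: leq_trans mD; rewrite ltnS.
  have Em : (mdeg ab.1 + mdeg ab.2)%N = mdeg m by rewrite -mdegD -E.
  by rewrite -[X in (_ < X)%N]Em -add1n leq_add2r lt0n mdeg_eq0.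
by rewrite (IH c (fun j => x (lift ord0 j))) ?mulr0.
Qed.

Lemma max_idealP s : reflect (~ exists t, s * t = 1) (s \in max_ideal).
Proof.
apply: (iffP idP) => [s0 [t st]|ns].
  have := @mscoef_prod 1 t (fun=> s) 0%MM (fun=> s0).
  rewrite big_ord1 mulrC st mscoef1 eqxx mdeg0 => /(_ isT)/eqP.
  by rewrite oner_eq0.
apply/negPn/negP => s0; apply: ns.
set c := mscoef s 0%MM; have c0 : c != 0 by exact: s0.
pose u : S := 1 - c^-1 *: s.
have um : u \in max_ideal.
  by apply/eqP; rewrite [LHS]mscoefB mscoef1 mscoefZ eqxx mulVf // subrr.
have uX j m : (mdeg m < j)%N -> mscoef (u ^+ j) m = 0.
  move=> mj; have := @mscoef_prod j 1 (fun=> u) m (fun=> um) mj.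
  by rewrite mul1r prodr_const card_ord.
pose G N : S := c^-1 *: \sum_(j < N.+1) u ^+ j.
exists (MSeries (fun m => mscoef (G (mdeg m)) m)).
apply: mseriesP => m; rewrite [LHS]ms_mulE.
have sG : s * G (mdeg m) = 1 - u ^+ (mdeg m).+1.
  have -> : s * G (mdeg m) = (1 - u) * \sum_(j < (mdeg m).+1) u ^+ j.
    by rewrite /u opprB addrC subrK /G -scalerAr scalerAl.
  rewrite -[X in _ = X - _](expr1n _ (mdeg m).+1) subrXX; congr (_ * _).
  by apply: eq_bigr => j _; rewrite expr1n mul1r.
transitivity (mscoef (s * G (mdeg m)) m); last first.
  by rewrite sG mscoefB uX // subr0.
rewrite [RHS]ms_mulE; apply: eq_conv => // a am.
rewrite [LHS]/(mscoef (G (mdeg a)) a) /G !mscoefZ !mscoef_sum; congr (_ * _).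
rewrite -(subnKC am) -addSn big_split_ord /= [X in _ = _ + X]big1 ?addr0 //.
  by rewrite mscoef_sum.
by move=> j _; apply: uX; rewrite addSn ltnS leq_addr.
Qed.

End PowerSeries.

(* Products of D elements of I generate the D-th power of the ideal I.        *)
Definition ideal_exp (A : comNzRingType) (I : {pred A}) (D : nat) (s : A) :=
  exists (r : nat) (c : 'I_r -> A) (x : 'I_r -> 'I_D -> A),
    (forall i j, x i j \in I) /\ s = \sum_i c i * \prod_j x i j.

Section IdealPowers.
Variables (A : comNzRingType) (I : {pred A}).

Lemma ideal_exp_prod D (c : A) (x : 'I_D -> A) :
  (forall j, x j \in I) -> ideal_exp I D (c * \prod_j x j).
Proof.
by move=> xI; exists 1, (fun=> c), (fun=> x); split=> //; rewrite big_ord1.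
Qed.

Lemma ideal_exp0 D : ideal_exp I D 0.
Proof. by exists 0, (fun=> 0), (fun=> fun=> 0); split=> [[]|]; rewrite ?big_ord0. Qed.

Lemma ideal_expD D s t :
  ideal_exp I D s -> ideal_exp I D t -> ideal_exp I D (s + t).
Proof.
move=> [r [c [x [xI ->]]]] [r' [c' [x' [xI' ->]]]].
exists (r + r')%N, (fun i : 'I_(r + r') => match fintype.split i with inl i => c i | inr i => c' i end),
  (fun i : 'I_(r + r') => match fintype.split i with inl i => x i | inr i => x' i end); split.
  by move=> i j; case: (fintype.split i) => i'.
rewrite big_split_ord /=; congr (_ + _); apply: eq_bigr => i _.
  by rewrite (unsplitK (inl i)).
by rewrite (unsplitK (inr i)).
Qed.

Lemma ideal_expMl D c s : ideal_exp I D s -> ideal_exp I D (c * s).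
Proof.
move=> [r [d [x [xI ->]]]]; exists r, (fun i => c * d i), x; split=> //.
by rewrite big_distrr; apply: eq_bigr => i _ /=; rewrite mulrA.
Qed.

Lemma ideal_expS D y s :
  y \in I -> ideal_exp I D s -> ideal_exp I D.+1 (y * s).
Proof.
move=> yI [r [c [x [xI ->]]]].
exists r, c, (fun i j => if unlift ord0 j is Some j' then x i j' else y); split.
  by move=> i j; case: (unlift _ _).
rewrite big_distrr; apply: eq_bigr => i _ /=.
rewrite big_ord_recl unlift_none mulrCA; congr (_ * (_ * _)).
by apply: eq_bigr => j _; rewrite liftK.
Qed.

Lemma ideal_exp_sum D (T : Type) (r : seq T) (Q : pred T) (F : T -> A) :
  (forall i, Q i -> ideal_exp I D (F i)) ->
  ideal_exp I D (\sum_(i <- r | Q i) F i).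
Proof.
move=> IF; elim/big_rec: _ => [|i s Qi Is]; first exact: ideal_exp0.
by apply: ideal_expD => //; exact: IF.
Qed.

End IdealPowers.

Section Order.
Variables (n : nat) (k : fieldType).
Local Notation S := (mseries n k).
Local Notation m := (@max_ideal n k).

Lemma ideal_exp_order D (s : S) :
  ideal_exp m D s <-> forall a, (mdeg a < D)%N -> mscoef s a = 0.
Proof.
split=> [[r [c [x [xm ->]]]] a aD|].
  by rewrite mscoef_sum big1 // => i _; rewrite mscoef_prod.
elim: D s => [|D IH] s s0.
  have := @ideal_exp_prod _ m 0 s (fun=> 0).
  by rewrite big_ord0 mulr1; apply=> -[].
pose part (i : 'I_n) : S := MSeries (fun b =>
  if [pick j | (b + U_(i))%MM j != 0%N] == Some i
  then mscoef s (b + U_(i))%MM else 0).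
have -> : s = \sum_i monomial k U_(i)%MM * part i.
  apply: mseriesP => a; rewrite mscoef_sum.
  under eq_bigr do rewrite mscoefXM lep1mP.
  have E i : (if a i != 0%N then mscoef (part i) (a - U_(i))%MM else 0) =
      if [pick j | a j != 0%N] == Some i then mscoef s a else 0.
    case: ifP => ai /=; first by rewrite submK // lep1mP.
    by case: pickP => [j aj|] //; case: eqP => // -[ji]; rewrite -ji aj in ai.
  rewrite (eq_bigr _ (fun i _ => E i)) -big_mkcond /=.
  case: pickP => [j aj|a0].
    by rewrite (eq_bigl (pred1 j)) ?big_pred1_eq // => i; rewrite eq_sym.
  rewrite big_pred0 // s0 // (_ : a = 0%MM) ?mdeg0 //.
  by apply/mnmP => i; rewrite mnm0E; move/eqP: (a0 i).
apply: ideal_exp_sum => i _; apply: ideal_expS.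
  by apply/eqP => /=; rewrite eq_sym mnm1_eq0.
apply: IH => b bD; rewrite /=; case: ifP => // _; apply: s0.
by rewrite mdegD mdeg1 addn1.
Qed.

End Order.

Section DividedPowers.
Variables (n : nat) (k : fieldType).
Local Notation S := (mseries n k).
Local Notation m := (@max_ideal n k).

(* The carrier of the divided power ring P.                                   *)
Definition in_divpow (f : S -> k^o) : Prop :=
  linear f /\ exists D0, forall D, (D0 <= D)%N ->
    forall s, ideal_exp m D s -> f s = 0.

Definition divpow_pred : {pred S -> k^o} := fun f => `[< in_divpow f >].

Record divpow := DivPow { dpfun : S -> k^o; _ : dpfun \in divpow_pred }.

HB.instance Definition _ := [isSub for dpfun].
HB.instance Definition _ := [Choice of divpow by <:].

Fact divpow_submod : submod_closed divpow_pred.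
Proof.
split.
  by apply/asboolP; split=> [c s t|]; [rewrite scaler0 addr0 | exists 0].
move=> c f g /asboolP[flin [D f0]] /asboolP[glin [E g0]]; apply/asboolP; split.
  move=> d s t; rewrite -[LHS]/(c *: f (d *: s + t) + g (d *: s + t)).
  rewrite -[X in _ = X + _]/(d *: (c *: f s + g s)).
  rewrite -[X in _ = _ + X]/(c *: f t + g t) flin glin.
  by rewrite !scalerDr !scalerA [d * c]mulrC addrACA.
exists (maxn D E) => F; rewrite geq_max => /andP[DF EF] s sF.
rewrite -[LHS]/(c *: f s + g s).
by rewrite (f0 F) // (g0 F) // scaler0 addr0.
Qed.

HB.instance Definition _ := GRing.isSubmodClosed.Build k (S -> k^o) divpow_pred
  divpow_submod.
HB.instance Definition _ := [SubChoice_isSubLmodule of divpow by <:].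

Implicit Types (f g h : divpow) (s t : S) (a b : 'X_{1..n}).

Definition pairing (s : S) (f : divpow) : k := dpfun f s.

Lemma divpowP f g : (forall s, pairing s f = pairing s g) -> f = g.
Proof. by move=> fg; apply: val_inj; apply: funext. Qed.

Lemma pairing_linear f : linear (dpfun f).
Proof. by case: f => f /= /asboolP[]. Qed.

HB.instance Definition _ f :=
  GRing.isLinear.Build k S k^o *:%R (dpfun f) (pairing_linear f).

Lemma pairing_vanish f : exists D0, forall D, (D0 <= D)%N ->
  forall s, ideal_exp m D s -> pairing s f = 0.
Proof. by case: f => f /= /asboolP[]. Qed.

Lemma pairingDr s f g : pairing s (f + g) = pairing s f + pairing s g.
Proof. by []. Qed.
Lemma pairingZr s c f : pairing s (c *: f) = c * pairing s f.
Proof. by []. Qed.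
Lemma pairing0r s : pairing s 0 = 0. Proof. by []. Qed.
Lemma pairing_sumr s (T : Type) (r : seq T) (Q : pred T) (F : T -> divpow) :
  pairing s (\sum_(i <- r | Q i) F i) = \sum_(i <- r | Q i) pairing s (F i).
Proof. by elim/big_rec2: _ => //= i x y _ <-. Qed.
Lemma pairingDl s t f : pairing (s + t) f = pairing s f + pairing t f.
Proof. exact: (linearD (dpfun f)). Qed.
Lemma pairingZl s c f : pairing (c *: s) f = c * pairing s f.
Proof. exact: (linearZ_LR (dpfun f) c s). Qed.
Lemma pairing0l f : pairing 0 f = 0. Proof. exact: (linear0 (dpfun f)). Qed.
Lemma pairingBl s t f : pairing (s - t) f = pairing s f - pairing t f.
Proof. exact: (linearB (dpfun f)). Qed.
Lemma pairing_suml (T : Type) (r : seq T) (Q : pred T) (F : T -> S) f :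
  pairing (\sum_(i <- r | Q i) F i) f = \sum_(i <- r | Q i) pairing (F i) f.
Proof. exact: (linear_sum (dpfun f)). Qed.

(* The basis dual to the monomials. *)
Fact dpbasis_subproof a : (fun s => mscoef s a : k^o) \in divpow_pred.
Proof.
apply/asboolP; split=> // ; exists (mdeg a).+1 => D aD s /ideal_exp_order.
exact.
Qed.
Definition dpbasis a : divpow := DivPow (dpbasis_subproof a).

Lemma pairing_dpbasis s a : pairing s (dpbasis a) = mscoef s a.
Proof. by []. Qed.

Lemma dpbasis_dual a b : pairing (monomial k b) (dpbasis a) = (a == b)%:R.
Proof. by []. Qed.

Lemma pairing_expand f : exists D,
  (forall a, (D <= mdeg a)%N -> pairing (monomial k a) f = 0) /\
  (forall s, pairing s f =
     \sum_(a : 'X_{1..n < D}) mscoef s a * pairing (monomial k a) f).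
Proof.
have [D fD] := pairing_vanish f; exists D; split=> [a aD|s].
  apply: (fD D) => //; apply/ideal_exp_order => b bD /=.
  by case: eqP => // E; move: aD; rewrite -E leqNgt bD.
apply/eqP; rewrite -subr_eq0; apply/eqP.
have -> : \sum_(a : 'X_{1..n < D}) mscoef s a * pairing (monomial k a) f =
   pairing (\sum_(a : 'X_{1..n < D}) mscoef s a *: monomial k a) f.
  by rewrite pairing_suml; apply: eq_bigr => a _; rewrite pairingZl.
rewrite -pairingBl; apply: (fD D) => //; apply/ideal_exp_order => b bD.
rewrite mscoefB mscoef_sum.
rewrite -[X in X - _](@bsum_pred1 _ _ D b (mscoef s)) ?[(D <= _)%N]leqNgt ?bD //.
rewrite -sumrB big1 // => a _; rewrite mscoefZ /=.
by case: eqP => _; rewrite ?mulr1 ?mulr0 subrr.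
Qed.

Lemma divpow_coefP f g :
  (forall a, pairing (monomial k a) f = pairing (monomial k a) g) -> f = g.
Proof.
move=> fg; apply: divpowP => s.
have [D [fD fE]] := pairing_expand f; have [E [gE gE']] := pairing_expand g.
have W F a : pairing (monomial k a) F = 0 -> mscoef s a * pairing (monomial k a) F = 0.
  by move=> ->; rewrite mulr0.
rewrite fE gE' (@bsum_fsum _ _ D (fun a => mscoef s a * pairing (monomial k a) f));
  last by move=> a /fD; exact: W.
rewrite (@bsum_fsum _ _ E (fun a => mscoef s a * pairing (monomial k a) g));
  last by move=> a /gE; exact: W.
by apply: eq_fsbigr => a _; rewrite fg.
Qed.

(* Contraction and the dual of an endomorphism. *)
Fact contract_subproof s f : (fun t => pairing (t * s) f : k^o) \in divpow_pred.
Proof.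
apply/asboolP; split=> [c t u|]; first by rewrite mulrDl -scalerAl pairingDl pairingZl.
have [D0 fD] := pairing_vanish f; exists D0 => D DD t tD.
by apply: (fD D) => //; rewrite mulrC; exact: ideal_expMl.
Qed.
Definition contract s f : divpow := DivPow (contract_subproof s f).

Lemma pairing_contract t s f : pairing t (contract s f) = pairing (t * s) f.
Proof. by []. Qed.

Lemma lrmorph_max_ideal (phi : {lrmorphism S -> S}) s :
  s \in m -> phi s \in m.
Proof.
move=> sm; apply/negPn/negP => ps.
set c := mscoef (phi s) 0%MM.
have : (phi (s - c%:A)) \in m.
  rewrite linearB linearZ /= rmorph1; apply/eqP.
  by rewrite [LHS]mscoefB mscoefZ mscoef1 eqxx mulr1 subrr.
move/max_idealP; apply.
have : s - c%:A \notin m.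
  rewrite -[_ \in _]/(mscoef (s - c%:A) 0%MM == 0) mscoefB (eqP (sm : is_true (mscoef s 0%MM == 0))).
  by rewrite mscoefZ mscoef1 eqxx mulr1 sub0r oppr_eq0.
move/(elimN (max_idealP _))/contrapT => [t st].
by exists (phi t); rewrite -rmorphM st rmorph1.
Qed.

Fact dual_map_subproof (phi : {lrmorphism S -> S}) f :
  (fun s => pairing (phi s) f : k^o) \in divpow_pred.
Proof.
apply/asboolP; split=> [c s t|]; first by rewrite linearP pairingDl pairingZl.
have [D0 fD] := pairing_vanish f; exists D0 => D DD s.
move=> [r [d [x [xm ->]]]]; apply: (fD D) => //.
rewrite rmorph_sum; apply: ideal_exp_sum => i _; rewrite rmorphM rmorph_prod.
by apply: ideal_exp_prod => j; exact: lrmorph_max_ideal.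
Qed.
Definition dual_map (phi : {lrmorphism S -> S}) f : divpow :=
  DivPow (dual_map_subproof phi f).

Lemma pairing_dual_map phi s f :
  pairing s (dual_map phi f) = pairing (phi s) f.
Proof. by []. Qed.

(* The product is the bilinear extension of                                   *)
(* x^[a] * x^[b] = mbinom a b x^[a + b]; see [dpbasisM].                      *)
Definition mbinom a b : nat := \prod_(i < n) 'C(a i + b i, a i).

Definition dp_mul f g : divpow :=
  \sum_(ab \in [set: 'X_{1..n} * 'X_{1..n}])
    (pairing (monomial k ab.1) f * pairing (monomial k ab.2) g
       * (mbinom ab.1 ab.2)%:R) *: dpbasis (ab.1 + ab.2)%MM.

Local Notation dp_conv := (conv (fun a b : 'X_{1..n} => (mbinom a b)%:R : k)).
Local Notation coef f := (fun a => pairing (monomial k a) f).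

Lemma dp_mulE f g : exists D E,
  (forall a, (D <= mdeg a)%N -> pairing (monomial k a) f = 0) /\
  (forall a, (E <= mdeg a)%N -> pairing (monomial k a) g = 0) /\
  dp_mul f g = \sum_(a : 'X_{1..n < D}) \sum_(b : 'X_{1..n < E})
    (coef f a * coef g b * (mbinom a b)%:R) *: dpbasis (a + b)%MM.
Proof.
have [D [fD _]] := pairing_expand f; have [E [gE _]] := pairing_expand g.
exists D, E; split=> //; split=> //.
pose F (ab : 'X_{1..n} * 'X_{1..n}) := (coef f ab.1 * coef g ab.2 *
   (mbinom ab.1 ab.2)%:R) *: dpbasis (ab.1 + ab.2)%MM.
rewrite pair_big /=.
set r := [seq (bmnm ab.1, bmnm ab.2) | ab <- enum {: 'X_{1..n < D, E}}].
rewrite -[RHS]big_enum -(big_map (fun ab : 'X_{1..n < D, E} =>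
   (bmnm ab.1, bmnm ab.2)) xpredT F) -/r.
have ur : uniq r.
  by rewrite map_inj_uniq ?enum_uniq // => -[a b] [a' b'] /= [/val_inj-> /val_inj->].
rewrite bigfs //.
  by congr (\sum_(ab \in _) F ab); apply/seteqP; split.
move=> [a b] _ abr; rewrite /F /=.
have [aD|/fD ->] := ltnP (mdeg a) D; last by rewrite !mul0r scale0r.
have [bE|/gE ->] := ltnP (mdeg b) E; last by rewrite mulr0 mul0r scale0r.
case/negP: abr; apply/mapP.
by exists (@BMultinom n D a aD, @BMultinom n E b bE); rewrite ?mem_enum.
Qed.

Lemma coef_dp_mul f g a :
  pairing (monomial k a) (dp_mul f g) = dp_conv (coef f) (coef g) a.
Proof.
have [D [E [fD [gE ->]]]] := dp_mulE f g.
pose N := maxn (maxn D E) (mdeg a).+1.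
have DN : (D <= N)%N by rewrite /N -maxnA leq_maxl.
have EN : (E <= N)%N by rewrite /N maxnAC leq_maxr.
have aN : (mdeg a < N)%N by rewrite /N leq_maxr.
rewrite (@convE _ _ _ N) // pairing_sumr.
rewrite -(@bsum_widen _ _ D N (fun x => pairing (monomial k a)
  (\sum_(b : 'X_{1..n < E}) (coef f x * coef g b * (mbinom x b)%:R)
       *: dpbasis (x + b)%MM))) //; last first.
  by move=> x /fD E0; rewrite big1 // => b _; rewrite E0 !mul0r scale0r.
apply: eq_bigr => x _; rewrite pairing_sumr.
rewrite -(@bsum_widen _ _ E N (fun b => pairing (monomial k a)
  ((coef f x * coef g b * (mbinom x b)%:R) *: dpbasis (x + b)%MM))) //; last first.
  by move=> b /gE E0; rewrite E0 mulr0 mul0r scale0r.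
apply: eq_bigr => b _; rewrite pairingZr dpbasis_dual eq_sym.
by case: eqP => _; rewrite ?mulr0 // mulr1 mulrC.
Qed.

Let coef_dp_mul_fun f g : coef (dp_mul f g) = dp_conv (coef f) (coef g).
Proof. by apply: funext => a; exact: coef_dp_mul. Qed.

Lemma mbinomC a b : mbinom a b = mbinom b a.
Proof.
apply: eq_bigr => i _; rewrite -bin_sub ?leq_addr // addKn addnC //.
Qed.

Lemma mbinomA a b (c : 'X_{1..n}) : (mbinom (a + b) c * mbinom a b =
  mbinom a (b + c) * mbinom b c)%N.
Proof.
rewrite -!big_split; apply: eq_bigr => i _ /=; rewrite !mnmDE.
set x := a i; set y := b i; set z := c i.
have P : (0 < x`! * (y`! * z`!))%N by rewrite !muln_gt0 !fact_gt0.
apply/eqP; rewrite -(eqn_pmul2r P); apply/eqP.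
have H u v : ('C(u + v, u) * (u`! * v`!) = (u + v)`!)%N.
  by rewrite -(@bin_fact (u + v) u) ?leq_addr // addKn.
transitivity ('C(x + y + z, x + y) * ('C(x + y, x) * (x`! * y`!) * z`!))%N.
  by rewrite !mulnA.
rewrite H H.
transitivity ('C(x + (y + z), x) * (x`! * ('C(y + z, y) * (y`! * z`!))))%N.
  by rewrite H H addnA.
by rewrite !mulnA; congr (_ * _ * _)%N; rewrite mulnAC.
Qed.

Let wC a b : (mbinom a b)%:R = (mbinom b a)%:R :> k.
Proof. by rewrite mbinomC. Qed.
Let wA a b c : (mbinom (a + b)%MM c)%:R * (mbinom a b)%:R =
  (mbinom a (b + c)%MM)%:R * (mbinom b c)%:R :> k.
Proof. by rewrite -!natrM mbinomA. Qed.

Let coef_dpbasis a : coef (dpbasis a) = fun b => (b == a)%:R.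
Proof. by apply: funext => b; rewrite dpbasis_dual eq_sym. Qed.

Fact dp_mulC : commutative dp_mul.
Proof.
by move=> f g; apply: divpow_coefP => a; rewrite !coef_dp_mul (convC wC).
Qed.
Fact dp_mulA : associative dp_mul.
Proof.
move=> f g h; apply: divpow_coefP => a.
by rewrite !coef_dp_mul !coef_dp_mul_fun (convA wC wA).
Qed.
Fact dp_mul1 : left_id (dpbasis 0%MM) dp_mul.
Proof.
move=> f; apply: divpow_coefP => a; rewrite coef_dp_mul coef_dpbasis conv_delta.
have -> : (0 <= a)%MM by apply/mnm_lepP => i; rewrite mnm0E.
rewrite subm0 /mbinom big1 ?mul1r // => i _.
by rewrite mnm0E bin0.
Qed.
Fact dp_mulDl : left_distributive dp_mul +%R.
Proof.
move=> f g h; apply: divpow_coefP => a; rewrite pairingDr !coef_dp_mul.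
exact: convDl.
Qed.
Fact dp_1neq0 : dpbasis 0%MM != 0.
Proof.
apply/eqP => /(congr1 (pairing (monomial k 0%MM))).
by rewrite dpbasis_dual eqxx pairing0r => /eqP; rewrite oner_eq0.
Qed.

HB.instance Definition _ := GRing.Zmodule_isComNzRing.Build divpow
  dp_mulA dp_mulC dp_mul1 dp_mulDl dp_1neq0.

Lemma coef_divpowM f g a : pairing (monomial k a) (f * g) =
  \sum_(bc : 'X_{1..n < (mdeg a).+1, (mdeg a).+1} | a == (bc.1 + bc.2)%MM)
    (mbinom bc.1 bc.2)%:R *
    (pairing (monomial k bc.1) f * pairing (monomial k bc.2) g).
Proof. exact: coef_dp_mul. Qed.

Fact dp_scaleAl (c : k) f g : c *: (f * g) = (c *: f) * g.
Proof.
apply: divpow_coefP => a; rewrite pairingZr.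
rewrite [pairing _ (f * g)]coef_dp_mul [RHS]coef_dp_mul.
by rewrite (@convZl _ _ _ c (coef f)).
Qed.

HB.instance Definition _ := GRing.Lmodule_isLalgebra.Build k divpow dp_scaleAl.
HB.instance Definition _ := GRing.Lalgebra_isComAlgebra.Build k divpow.

Lemma dpbasisM a b :
  dpbasis a * dpbasis b = (mbinom a b)%:R *: dpbasis (a + b)%MM.
Proof.
apply: divpow_coefP => d; rewrite [LHS]coef_dp_mul !coef_dpbasis conv_delta.
rewrite pairingZr dpbasis_dual; case: ifP => ad.
  rewrite -{3}(submK ad) [(d - a + a)%MM]addmC eqm_add2l eq_sym.
  by case: eqP => [<-|]; rewrite ?mulr0.
case: eqP => [E|_]; last by rewrite mulr0.
by rewrite -E lem_addr in ad.
Qed.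

End DividedPowers.

Notation "''x^[' a ]" := (dpbasis _ a) (format "''x^[' a ]") : ring_scope.
Notation "s '_|' f" := (contract s f)
  (at level 40, left associativity) : ring_scope.

(* Main.v *)
(* Both sides are compared on a monomial alpha^b. Writing phi(alpha_i) as       *)
(* alpha_i + D_i and expanding phi(alpha^b) = prod_i (alpha_i + D_i)^(b_i)      *)
(* gives the terms binom(b, a) alpha^(b - a) D^a, and <alpha^b, x^[a] * g>      *)
(* is binom(b, a) <alpha^(b - a), g>. Only finitely many a contribute because   *)
(* phi is local, so that D^a lies in the |a|-th power of the maximal ideal,     *)
(* which f annihilates for |a| large.                                           *)
Require Import Defs.
From mathcomp Require Import all_boot all_order all_algebra.
From mathcomp Require Import boolp classical_sets functions cardinality fsbigop.
From mathcomp Require Import mpoly.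

Import GRing.Theory.
Local Open Scope ring_scope.
Local Open Scope classical_set_scope.

(** By [divpow_coefP] an element of P is determined by its values on monomials, so phi only has to
    be evaluated on the finite products alpha^b. There [lrmorph_monomial], a consequence of the
    multi-index binomial theorem [prod_exprD], and [coef_dpbasisM] give sums over a that agree term
    by term. Since D^a lies in m^|a|, its contraction kills f once |a| is large; this yields the
    finite support and reduces all sums to finite ones. *)

Lemma mnm_le_mdeg (n : nat) (a b : 'X_{1..n}) :
  (a <= b)%MM -> (mdeg a <= mdeg b)%N.
Proof. by move=> ab; rewrite -(submK ab) mdegD leq_addl. Qed.

(** Distributing the n binomial expansions gives a sum over the box [0, d)^n rather than over |a| <
    d. The summand vanishes unless a <= b, and all such a lie in both index sets. *)
Lemma prod_exprD (R : comNzRingType) (n d : nat) (x y : 'I_n -> R)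
    (b : 'X_{1..n}) : (mdeg b < d)%N ->
  \prod_(i < n) (x i + y i) ^+ b i =
  \sum_(a : 'X_{1..n < d})
    \prod_(i < n) (x i ^+ (b i - a i) * y i ^+ a i *+ 'C(b i, a i)).
Proof.
move=> bd.
pose F (a : 'X_{1..n}) : R :=
  \prod_(i < n) (x i ^+ (b i - a i) * y i ^+ a i *+ 'C(b i, a i)).
have F0 (a : 'X_{1..n}) : (~~ (a <= b)%MM) -> F a = 0.
  case/forallPn => i; rewrite -ltnNge => ba.
  by rewrite /F (bigD1 i) //= bin_small // mulr0n mul0r.
have b_lt i : (b i < d)%N.
  by apply: leq_ltn_trans bd; rewrite mdegE (bigD1 i) //= leq_addr.
rewrite (@bsum_fsum _ _ d F) => [|a da]; last first.
  apply: F0; apply: contraL da => /mnm_le_mdeg ab.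
  by rewrite -ltnNge (leq_ltn_trans ab).
transitivity (\prod_(i < n) \sum_(j < d)
    (x i ^+ (b i - j) * y i ^+ j *+ 'C(b i, j))).
  apply: eq_bigr => i _; rewrite exprDn.
  rewrite (big_ord_widen d
    (fun j => x i ^+ (b i - j) * y i ^+ j *+ 'C(b i, j))) //.
  rewrite big_mkcond; apply: eq_bigr => j _; case: ifP => // /negbT.
  by rewrite -leqNgt => bj; rewrite bin_small // mulr0n.
rewrite bigA_distr_bigA /=.
pose h (g : {ffun 'I_n -> 'I_d}) : 'X_{1..n} := [multinom (g i : nat) | i < n].
transitivity (\sum_(g : {ffun 'I_n -> 'I_d}) F (h g)).
  by apply: eq_bigr => g _; apply: eq_bigr => i _; rewrite mnmE.
have h_inj : injective h.
  move=> g g' /mnmP hg; apply/ffunP => i; apply: val_inj.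
  by have := hg i; rewrite !mnmE.
rewrite -[LHS]big_enum -(big_map h xpredT F) bigfs.
- by congr (\sum_(a \in _) F a); apply/seteqP; split.
- by rewrite map_inj_uniq ?enum_uniq.
move=> a _ ha; apply: F0; apply: contra ha => ab; apply/mapP.
have a_lt i : (a i < d)%N by exact: leq_ltn_trans (forallP ab i) (b_lt i).
exists [ffun i => Ordinal (a_lt i)]; first by rewrite mem_enum.
by apply/mnmP => i; rewrite mnmE ffunE.
Qed.

Lemma ideal_exp_exprM (A : comNzRingType) (I : {pred A}) (d e : nat) (y s : A) :
  y \in I -> ideal_exp I d s -> ideal_exp I (e + d) (y ^+ e * s).
Proof.
move=> yI sd; elim: e => [|e IH]; first by rewrite mul1r.
by rewrite exprS -mulrA; exact: ideal_expS.
Qed.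

Lemma monomialE (k : fieldType) (n : nat) (b : 'X_{1..n}) :
  monomial k b = \prod_(i < n) monomial k U_(i)%MM ^+ b i.
Proof.
rewrite {1}(multinomUE_id b).
elim/big_rec2: _ => [//|i s c _ <-].
rewrite monomialD; congr (_ * _).
elim: (b i) => [|m IH]; first by rewrite mulm0n expr0.
by rewrite mulmS monomialD IH exprS.
Qed.

(** Convolution with a delta family has a single term. For a <= b its weight is the product of the
    C(b_i, a_i). *)
Lemma coef_dpbasisM (k : fieldType) (n : nat) (a b : 'X_{1..n})
    (g : divpow n k) :
  pairing (monomial k b) ('x^[a] * g) =
  if (a <= b)%MM then
    (mbinom a (b - a)%MM)%:R * pairing (monomial k (b - a)%MM) g
  else 0.
Proof.
rewrite [LHS]coef_dp_mul.
rewrite (_ : (fun c => pairing (monomial k c) 'x^[a]) = fun c => (c == a)%:R).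
  by rewrite conv_delta.
by apply: funext => c; rewrite dpbasis_dual eq_sym.
Qed.

(** The bound [d] is left free so that this sum can share its index set with the truncated sum for
    f. *)
Lemma lrmorph_monomial (k : fieldType) (n d : nat)
    (phi : {lrmorphism mseries n k -> mseries n k}) (b : 'X_{1..n}) :
  (mdeg b < d)%N ->
  phi (monomial k b) =
  \sum_(a : 'X_{1..n < d}) if (a <= b)%MM then
     (mbinom a (b - a)%MM)%:R *:
       (monomial k (b - a)%MM *
          \prod_(i < n)
            (phi (monomial k U_(i)%MM) - monomial k U_(i)%MM) ^+ a i)
   else 0.
Proof.
move=> bd; rewrite monomialE rmorph_prod.
transitivity (\prod_(i < n) (monomial k U_(i)%MM +
    (phi (monomial k U_(i)%MM) - monomial k U_(i)%MM)) ^+ b i).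
  by apply: eq_bigr => i _; rewrite addrC subrK rmorphXn.
rewrite (@prod_exprD _ _ d) //; apply: eq_bigr => a _.
case: ifP => [ab|/negbT/forallPn[i]]; last first.
  by rewrite -ltnNge => ba; rewrite (bigD1 i) //= bin_small // mulr0n mul0r.
rewrite prodrMn monomialE -big_split scaler_nat /mbinom /=; congr (_ *+ _).
  by apply: eq_bigr => i _; rewrite mnmBE.
by apply: eq_bigr => i _; rewrite mnmBE subnKC // (forallP ab i).
Qed.

Theorem proposition2p9 (k : closedFieldType) (n : nat)
    (phi : {lrmorphism mseries n k -> mseries n k}) (phi_bij : bijective phi)
    (f : divpow n k) :
  let D (i : 'I_n) : mseries n k :=
    phi (monomial k U_(i)%MM) - monomial k U_(i)%MM in
  let Dpow (a : 'X_{1..n}) : mseries n k := \prod_(i < n) D i ^+ a i in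
  [/\ finite_set [set a : 'X_{1..n} | 'x^[a] * (Dpow a _| f) != 0],
      dual_map phi f =
        \sum_(a \in [set: 'X_{1..n}]) 'x^[a] * (Dpow a _| f) &
      dual_map phi f =
        f + \sum_(i < n) 'x^[U_(i)%MM] * (D i _| f)
          + \sum_(a \in [set a : 'X_{1..n} | (1 < mdeg a)%N])
              'x^[a] * (Dpow a _| f)].
Proof.
move=> D Dpow.
have monU (i : 'I_n) : mscoef (monomial k U_(i)%MM) 0%MM = 0 :> k.
  by rewrite [LHS]/((0%MM == U_(i)%MM)%:R) eq_sym mnm1_eq0.
have D_max i : D i \in @max_ideal n k.
  have phiX : phi (monomial k U_(i)%MM) \in @max_ideal n k.
    by apply: lrmorph_max_ideal; apply/eqP; exact: monU.
  by apply/eqP; rewrite [LHS]mscoefB (eqP phiX) monU subrr.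
have Dpow_ideal a : ideal_exp (@max_ideal n k) (mdeg a) (Dpow a).
  rewrite mdegE; apply: (big_rec2 (ideal_exp (@max_ideal n k))) => [|i e s _ s_e].
    have := @ideal_exp_prod _ (@max_ideal n k) 0 1 (fun=> 0).
    by rewrite big_ord0 mulr1; apply=> -[].
  exact: ideal_exp_exprM (D_max i) s_e.
have [N fN] := pairing_vanish f.
pose G a := 'x^[a] * (Dpow a _| f).
(* For every t, t * D^a lies in m^|a|, on which f vanishes when |a| >= N. *)
have G0 a : (N <= mdeg a)%N -> G a = 0.
  move=> Na; rewrite /G (_ : Dpow a _| f = 0) ?mulr0 //; apply: divpowP => t.
  rewrite pairing_contract pairing0r; apply: fN Na _ _.
  exact: ideal_expMl.
have phiE : dual_map phi f = \sum_(a \in [set: 'X_{1..n}]) G a.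
  rewrite -(bsum_fsum G0); apply: divpow_coefP => b.
  (* The common bound: N covers the support of [G], and |b| + 1 is what the expansion of
     phi(alpha^b) requires. *)
  have bM : (mdeg b < maxn N (mdeg b).+1)%N by rewrite leq_max leqnn orbT.
  rewrite -(bsum_widen (leq_maxl N (mdeg b).+1) G0) pairing_dual_map.
  rewrite (lrmorph_monomial _ _ _ _ _ bM) pairing_suml pairing_sumr.
  apply: eq_bigr => a _; rewrite coef_dpbasisM; case: ifP => ab.
    by rewrite pairingZl pairing_contract.
  exact: pairing0l.
split=> //.
  apply: (@sub_finite_set _ _
      [set` [seq bmnm a | a <- enum {: 'X_{1..n < N}}]]).
    move=> a; case: (ltnP (mdeg a) N) => [aN _ | /G0 /eqP Ga]; last first.
      by rewrite /= -/(G a) Ga.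
    by apply/mapP; exists (BMultinom aN); rewrite ?mem_enum.
  exact: finite_seq.
rewrite phiE [X in _ = _ + X]fsbig_mkcond.
(* The tail extended by zero, so that it too becomes a sum over |a| < N. *)
pose G2 a := if (1 < mdeg a)%N then G a else 0.
have -> : \sum_(a \in [set: 'X_{1..n}])
    patch (fun=> 0) [set a : 'X_{1..n} | (1 < mdeg a)%N] G a =
  \sum_(a \in [set: 'X_{1..n}]) G2 a.
  apply: eq_fsbigr => a _; rewrite /patch /G2.
  by congr (if _ then _ else _); apply/idP/idP; rewrite inE.
have G20 a : (N <= mdeg a)%N -> G2 a = 0 by move=> /G0; rewrite /G2; case: ifP.
rewrite -(bsum_fsum G0) -(bsum_fsum G20).
have GfE : G 0%MM = f.
  rewrite /G (_ : Dpow 0%MM = 1).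
    rewrite -[RHS]mul1r; congr (_ * _); apply: divpowP => t.
    by rewrite pairing_contract mulr1.
  by rewrite /Dpow big1 // => i _; rewrite mnm0E.
have GUE i : G U_(i)%MM = 'x^[U_(i)%MM] * (D i _| f).
  rewrite /G /Dpow (bigD1 i) //= mnm1E eqxx expr1 big1 ?mulr1 // => j ji.
  by rewrite mnm1E eq_sym (negPf ji).
(* f and the linear terms become indicator sums over |a| < N. This holds even when N <= 1, since [G]
   vanishes at any index left out. It remains to compare summands for |a| = 0, |a| > 1 and |a| =
   1. *)
rewrite -(eq_bigr _ (fun i _ => GUE i)) -{1}GfE -(bsum_pred1 (G0 0%MM)).
under [X in _ + X + _]eq_bigr => i _ do rewrite -(bsum_pred1 (G0 U_(i)%MM)).
rewrite [X in _ + X + _]exchange_big -!big_split /=.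
apply: eq_bigr => a _; rewrite /G2.
move: (bmnm a) => {}a; case: (ltngtP (mdeg a) 1) => [a_0|a_gt1|/eqP/mdeg1P[i /eqP ->]].
- have -> : a = 0%MM by apply/eqP; rewrite -mdeg_eq0 -leqn0 -ltnS.
  by rewrite eqxx big1 ?addr0 // => i _; rewrite mnm1_eq0.
- rewrite ifN_eq; last by apply: contraL a_gt1 => /eqP <-; rewrite mdeg0.
  rewrite big1 ?add0r // => i _; rewrite ifN_eq //.
  by apply: contraL a_gt1 => /eqP <-; rewrite mdeg1.
- rewrite ifN_eqC ?mnm1_eq0 // add0r addr0 (bigD1 i) //= eqxx big1 ?addr0 //.
  move=> j ji; rewrite ifN_eq //; apply: contra ji => /eqP/mnmP/(_ i).
  by rewrite !mnm1E eqxx; case: eqP.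
Qed.
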